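(* Let $m=p^t$ be a prime power. (a) $\{K_{m\times m}, mK_m\}$ are equienergetic non-isospectral graphs of $m^2$ vertices for any $m\ge 2$. (b) $\{H_{m,m}, mK_2\}$ are equienergetic non-isospectral graphs of $2m$ vertices for any $m\ge 3$. In each pair, one of the graphs is connected while the other is not.
   Context: $K_a$ denotes the complete graph on $a$ vertices, and $mK_a$ is the disjoint union of $m$ copies of $K_a$. $K_{m\times m}$ is the complete $m$-multipartite graph of $m^2$ vertices, with $m$ parts of size $m$. $H_{m,m}$ is the crown graph of $2m$ vertices, that is, the complete bipartite graph $K_{m,m}$ with a perfect matching removed. The spectrum of a graph is the set of eigenvalues of its adjacency matrix counted with multiplicities, and its energy is the sum of the absolute values of these eigenvalues, counted with multiplicities. Two graphs with the same number of vertices are isospectral if they have the same spectrum, and equienergetic if they have the same energy.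
   Formalization: In (b), mK_2 is replaced by 2K_m (two copies of K_m): as printed (b) is false for every m ≥ 3, since H_{m,m} has energy 4(m−1) while mK_2 has energy 2m (for m = 3: 8 versus 6). *)

(* Defs.v *)
From HB Require Import structures.
From mathcomp Require Import all_boot all_order all_algebra all_field.

Set Implicit Arguments.
Unset Strict Implicit.
Unset Printing Implicit Defensive.

Import GRing.Theory Num.Theory.

Record sgraph := SGraph {
  vertex :> finType;
  edge : rel vertex;
  edge_sym : symmetric edge;
  edge_irrefl : irreflexive edge
}.

Definition connected (G : sgraph) : Prop :=
  forall x y : G, connect (@edge G) x y.

(* The entries are integers, so every eigenvalue lies in algC. *)
Definition adjacency (G : sgraph) : 'M[algC]_#|G| :=
  (\matrix_(i, j) (edge (enum_val i) (enum_val j))%:R)%R.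

(* Roots of the monic polynomial char_poly A, repeated according to
   multiplicity; only meaningful up to perm_eq. *)
Definition eigenvalues (n : nat) (A : 'M[algC]_n) : seq algC :=
  sval (closed_field_poly_normal (char_poly A)).

Definition spectrum (G : sgraph) : seq algC := eigenvalues (adjacency G).

Definition energy (G : sgraph) : algC := (\sum_(a <- spectrum G) `|a|)%R.

(* Equality of multisets; it already forces #|G| = #|H|. *)
Definition isospectral (G H : sgraph) : Prop :=
  perm_eq (spectrum G) (spectrum H).

Definition equienergetic (G H : sgraph) : Prop :=
  #|G| = #|H| /\ energy G = energy H.

Definition complete_edge (T : finType) : rel T := fun x y => x != y.

Fact complete_sym (T : finType) : symmetric (@complete_edge T).
Proof. by move=> x y; rewrite /complete_edge eq_sym. Qed.

Fact complete_irrefl (T : finType) : irreflexive (@complete_edge T).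
Proof. by move=> x; rewrite /complete_edge eqxx. Qed.

Definition complete (a : nat) : sgraph :=
  SGraph (@complete_sym 'I_a) (@complete_irrefl 'I_a).

Definition copies_edge (k : nat) (G : sgraph) : rel ('I_k * G)%type :=
  fun x y => (x.1 == y.1) && edge x.2 y.2.

Fact copies_sym k G : symmetric (@copies_edge k G).
Proof. by move=> x y; rewrite /copies_edge eq_sym edge_sym. Qed.

Fact copies_irrefl k G : irreflexive (@copies_edge k G).
Proof. by move=> x; rewrite /copies_edge edge_irrefl andbF. Qed.

(* The disjoint union kG of k copies of G; (i, x) is x in the i-th copy. *)
Definition copies (k : nat) (G : sgraph) : sgraph :=
  SGraph (@copies_sym k G) (@copies_irrefl k G).

Definition multipartite_edge (k a : nat) : rel ('I_k * 'I_a)%type :=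
  fun x y => x.1 != y.1.

Fact multipartite_sym k a : symmetric (@multipartite_edge k a).
Proof. by move=> x y; rewrite /multipartite_edge eq_sym. Qed.

Fact multipartite_irrefl k a : irreflexive (@multipartite_edge k a).
Proof. by move=> x; rewrite /multipartite_edge eqxx. Qed.

(* k parts of size a; the part of (i, x) is i. *)
Definition complete_multipartite (k a : nat) : sgraph :=
  SGraph (@multipartite_sym k a) (@multipartite_irrefl k a).

Definition crown_edge (a : nat) : rel (complete_multipartite 2 a) :=
  fun x y => edge x y && (x.2 != y.2).

Fact crown_sym a : symmetric (@crown_edge a).
Proof. by move=> x y; rewrite /crown_edge edge_sym eq_sym. Qed.

Fact crown_irrefl a : irreflexive (@crown_edge a).
Proof. by move=> x; rewrite /crown_edge edge_irrefl. Qed.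

(* K_{a,a} without the perfect matching made of the edges (0, i) -- (1, i).
   Its eigenvalues are a-1, 1-a (once each) and 1, -1 (a-1 times each), so its
   energy 4(a-1) is that of 2K_a; the energy of aK_2 is 2a, which differs for
   a >= 3. *)
Definition crown (a : nat) : sgraph :=
  SGraph (@crown_sym a) (@crown_irrefl a).

Definition exactly_one_connected (G H : sgraph) : Prop :=
  (connected G /\ ~ connected H) \/ (connected H /\ ~ connected G).

(* Main.v *)
Require Import Defs.
From mathcomp Require Import all_boot all_order all_algebra all_field.
From mathcomp Require Import ring.

(** Let I and J be the identity and the all-ones matrix of a given size.  On
    vertices indexed by pairs, the adjacency matrices of the graphs at hand are
    Kronecker products of matrices p I + q J:

      complete k-partite graph, parts of size a:   (J - I) (x) J,
      k disjoint copies of K_a:                    I (x) (J - I),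
      crown graph on 2a vertices:                  (J - I) (x) (J - I).

    The discrete Fourier basis of size n diagonalizes every p I + q J at once,
    with eigenvalue p + q n on the constant vector and p on all the others
    ([fourier_basis]).  Tensor products of two Fourier bases thus diagonalize
    the three adjacency matrices, and their eigenvalues are the products of
    the eigenvalues of the two factors ([tensor_spectrum]).  Hence the energy
    is multiplicative ([tensor_energy]).  As the absolute eigenvalue sums of I
    and J are both n, replacing I by J in a factor does not change the energy:
    the complete m-partite graph and m K_m both have energy 2 (m - 1) m.
    The absolute eigenvalue sum of J - I is 2 (n - 1), which for n = 2 is also
    that of I: the crown graph and 2 K_m both have energy 4 (m - 1).

    A single eigenvalue separates the spectra.  The eigenvalues of k K_a are
    a - 1 and -1; but J is singular, so that 0 is an eigenvalue of the complete
    multipartite graph, and the crown graph, being bipartite, has 1 - a as an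
    eigenvalue along with a - 1. *)

Set Implicit Arguments.
Unset Strict Implicit.
Unset Printing Implicit Defensive.

Import GRing.Theory Num.Theory.

Local Open Scope ring_scope.

(** * Spectra from eigenbases *)

Lemma eigenvalues_char_poly (n : nat) (A : 'M[algC]_n) (s : seq algC) :
  char_poly A = \prod_(x <- s) ('X - x%:P) -> perm_eq (eigenvalues A) s.
Proof.
move=> charA; apply: prod_XsubC_eq; rewrite -charA /eigenvalues.
case: closed_field_poly_normal => r /=.
by rewrite (monicP (char_poly_monic A)) scale1r.
Qed.

(** Stated as an intertwining relation rather than as a conjugation, so that
    the characteristic matrices are intertwined as well and the claim follows by
    cancelling the nonzero determinant of P over the polynomials. *)
Lemma char_poly_diagonalized (n : nat) (A P : 'M[algC]_n) (d : 'rV[algC]_n) :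
  P \in unitmx -> P *m A = diag_mx d *m P ->
  char_poly A = \prod_i ('X - (d 0 i)%:P).
Proof.
move=> Punit PA.
have charA : char_poly A = char_poly (diag_mx d).
  have detP_neq0 : \det (map_mx polyC P) != 0.
    by rewrite det_map_mx polyC_eq0 -unitfE -unitmxE.
  apply: (mulfI detP_neq0); rewrite [RHS]mulrC /char_poly -!det_mulmx.
  congr (\det _); rewrite /char_poly_mx mulmxBr mulmxBl -!map_mxM PA.
  by rewrite scalar_mxC.
rewrite charA char_poly_trig ?diag_mx_is_trig //.
by apply: eq_bigr => i _; rewrite mxE eqxx mulr1n.
Qed.

(** Frees the later computations from the enumeration of the vertices: an
    eigenbasis U indexed by the vertices themselves, and its inverse W, suffice.
    Since the rows of U may be indexed in any way by as many labels as there
    are vertices, vertices serve as labels too. *)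
Lemma spectrum_eigenbasis (G : sgraph) (U W : G -> G -> algC) (ev : G -> algC) :
  (forall a b, \sum_x U a x * W x b = (a == b)%:R) ->
  (forall a x, \sum_y U a y * (edge y x)%:R = ev a * U a x) ->
  perm_eq (spectrum G) [seq ev a | a : G].
Proof.
move=> UW Uev.
have sum_enum_val (F : G -> algC) : \sum_(i < #|G|) F (enum_val i) = \sum_x F x.
  rewrite [RHS](reindex (enum_val : 'I_#|G| -> G)) //.
  exact: onW_bij (enum_val_bij G).
pose P := \matrix_(i < #|G|, j < #|G|) U (enum_val i) (enum_val j).
pose Q := \matrix_(i < #|G|, j < #|G|) W (enum_val i) (enum_val j).
pose d := \row_(i < #|G|) ev (enum_val i).
have PQ : P *m Q = 1%:M.
  apply/matrixP=> i j; rewrite !mxE -(inj_eq enum_val_inj) -UW -sum_enum_val.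
  by apply: eq_bigr => k _; rewrite !mxE.
have [Punit _] := mulmx1_unit PQ.
apply: eigenvalues_char_poly.
rewrite (char_poly_diagonalized (P := P) (d := d)) //.
  rewrite big_image /= [RHS](reindex (enum_val : 'I_#|G| -> G)) /=; last first.
    exact: onW_bij (enum_val_bij G).
  by apply: eq_bigr => i _; rewrite mxE.
apply/matrixP=> i j; rewrite mul_diag_mx !mxE -Uev -sum_enum_val.
by apply: eq_bigr => k _; rewrite !mxE.
Qed.

(** * Kronecker products of matrices p I + q J *)

Definition pIqJ (p q : algC) (n : nat) (i j : 'I_n) : algC :=
  p * (i == j)%:R + q.

(** The index 0 stands for the constant vector, on which J acts as n; the other
    indices stand for vectors with coordinate sum 0. *)
Definition pIqJ_eigenvalue (p q : algC) (n : nat) (i : 'I_n) : algC :=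
  p + q * (n%:R * (i == 0 :> nat)%:R).

(** Take U i x = z ^ (i x) for a primitive n-th root of unity z: its rows are
    orthogonal, and only row 0 has a nonzero coordinate sum.  One basis serves
    all p and q because it diagonalizes J. *)
Lemma fourier_basis (n : nat) : (0 < n)%N ->
  exists U W : 'I_n -> 'I_n -> algC,
    (forall i j, \sum_x U i x * W x j = (i == j)%:R) /\
    (forall p q i x, \sum_y U i y * pIqJ p q y x
       = pIqJ_eigenvalue p q i * U i x).
Proof.
move=> n_gt0; have [z zP] := C_prim_root_exists n_gt0.
have n_neq0 : n%:R != 0 :> algC by rewrite pnatr_eq0 -lt0n.
have z_neq0 : z != 0 by rewrite (prim_root_eq0 zP) -lt0n.
have geom (w : algC) : w ^+ n = 1 ->
    \sum_(x < n) w ^+ x = n%:R * (w == 1)%:R.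
  move=> wn; have [->|w_neq1] := eqVneq w 1.
    rewrite mulr1 -[in RHS](card_ord n) -sumr_const.
    by apply: eq_bigr => x _; rewrite expr1n.
  apply: (mulfI (x := w - 1)); first by rewrite subr_eq0.
  by rewrite -subrX1 wn subrr mulr0 mulr0.
(* W is the inverse Fourier transform, hence the division by n. *)
exists (fun i x => z ^+ (i * x)), (fun x j => (z ^- (j * x)) / n%:R).
split=> [i j|p q i x].
  under eq_bigr => x _ do rewrite mulrA !exprM -exprVn -exprMn.
  rewrite -mulr_suml geom.
    rewrite mulrC mulrA mulVf // mul1r; congr (nat_of_bool _)%:R.
    have zj_neq0 : z ^+ j != 0 by rewrite expf_neq0.
    rewrite -subr_eq0 -(mulIr_eq0 _ (mulIf zj_neq0)) mulrBl mulfVK // mul1r.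
    by rewrite subr_eq0 (eq_prim_root_expr zP) !modn_small.
  rewrite exprMn exprVn -!exprM ![(_ * n)%N]mulnC !exprM (prim_expr_order zP).
  by rewrite !expr1n invr1 mulr1.
have sum_row : \sum_(y < n) z ^+ (i * y) = n%:R * (i == 0 :> nat)%:R.
  under eq_bigr => y _ do rewrite exprM.
  rewrite geom; last by rewrite -exprM mulnC exprM (prim_expr_order zP) expr1n.
  congr (_ * (nat_of_bool _)%:R).
  by rewrite -(prim_order_dvd zP) /dvdn modn_small.
rewrite /pIqJ /pIqJ_eigenvalue; under eq_bigr => y _ do rewrite mulrDr.
rewrite big_split /= -mulr_suml sum_row (bigD1 x) //= eqxx mulr1.
rewrite big1 ?addr0 => [|y /negPf->]; last by rewrite !mulr0.
rewrite mulrDl mulrC; congr (_ + _).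
(* The J part yields q * n only for i = 0, and there U i x = 1. *)
have [->|_] := eqVneq (i : nat) 0%N; last by rewrite !mulr0 !mul0r.
by rewrite mul0n expr0 !mulr1 mulrC.
Qed.

(** Edges are tested coordinatewise, so products of eigenvectors of the two
    factors are eigenvectors; their inverse basis is the product of the two
    inverse bases. *)
Lemma tensor_spectrum (k a : nat) (p1 q1 p2 q2 : algC)
    (e : rel ('I_k * 'I_a)) (e_sym : symmetric e) (e_irrefl : irreflexive e) :
  (0 < k)%N -> (0 < a)%N ->
  (forall x y, (e x y)%:R = pIqJ p1 q1 x.1 y.1 * pIqJ p2 q2 x.2 y.2) ->
  perm_eq (spectrum (SGraph e_sym e_irrefl))
    [seq pIqJ_eigenvalue p1 q1 x.1 * pIqJ_eigenvalue p2 q2 x.2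
       | x : 'I_k * 'I_a].
Proof.
move=> k_gt0 a_gt0 eE.
have [U1 [W1 [UW1 evU1]]] := fourier_basis k_gt0.
have [U2 [W2 [UW2 evU2]]] := fourier_basis a_gt0.
apply: (@spectrum_eigenbasis (SGraph e_sym e_irrefl)
  (fun x y => U1 x.1 y.1 * U2 x.2 y.2) (fun x y => W1 x.1 y.1 * W2 x.2 y.2)
  (fun x => pIqJ_eigenvalue p1 q1 x.1 * pIqJ_eigenvalue p2 q2 x.2)).
- move=> x y; rewrite -[x == y]/((x.1 == y.1) && (x.2 == y.2)) -mulnb natrM.
  rewrite -UW1 -UW2 big_distrlr /= pair_bigA; apply: eq_bigr => z _ /=.
  by rewrite mulrACA.
- move=> x y; rewrite mulrACA -evU1 -evU2 big_distrlr /= pair_bigA.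
  by apply: eq_bigr => z _ /=; rewrite eE mulrACA.
Qed.

(** Serves to tell spectra apart by a single eigenvalue. *)
Lemma tensor_mem_spectrum (k a : nat) (p1 q1 p2 q2 : algC)
    (e : rel ('I_k * 'I_a)) (e_sym : symmetric e) (e_irrefl : irreflexive e) v :
  (0 < k)%N -> (0 < a)%N ->
  (forall x y, (e x y)%:R = pIqJ p1 q1 x.1 y.1 * pIqJ p2 q2 x.2 y.2) ->
  reflect (exists x : 'I_k * 'I_a,
             v = pIqJ_eigenvalue p1 q1 x.1 * pIqJ_eigenvalue p2 q2 x.2)
    (v \in spectrum (SGraph e_sym e_irrefl)).
Proof.
move=> k_gt0 a_gt0 eE.
rewrite (perm_mem (tensor_spectrum e_sym e_irrefl k_gt0 a_gt0 eE)).
by apply: (iffP imageP) => [[x _ ->]|[x ->]]; exists x.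
Qed.

Lemma pIqJ_absolute_sum (p q : algC) (n : nat) : (0 < n)%N ->
  \sum_(i < n) `|pIqJ_eigenvalue p q i| = `|p + q * n%:R| + `|p| * n.-1%:R.
Proof.
case: n => // n _; rewrite big_ord_recl /pIqJ_eigenvalue /= mulr1.
congr (_ + _).
under eq_bigr => i _ do rewrite !mulr0 addr0.
by rewrite sumr_const card_ord mulr_natr.
Qed.

Lemma eq_absolute_sum (n : nat) : (0 < n)%N ->
  \sum_(i < n) `|pIqJ_eigenvalue 1 0 i| = n%:R.
Proof.
move=> n_gt0; rewrite pIqJ_absolute_sum // mul0r addr0 normr1 mul1r addrC.
by rewrite natr1 prednK.
Qed.

Lemma true_absolute_sum (n : nat) : (0 < n)%N ->
  \sum_(i < n) `|pIqJ_eigenvalue 0 1 i| = n%:R.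
Proof.
move=> n_gt0; rewrite pIqJ_absolute_sum // add0r normr0 mul0r addr0.
by rewrite mul1r normr_nat.
Qed.

Lemma neq_absolute_sum (n : nat) : (0 < n)%N ->
  \sum_(i < n) `|pIqJ_eigenvalue (-1) 1 i| = 2%:R * n.-1%:R.
Proof.
move=> n_gt0; rewrite pIqJ_absolute_sum // mul1r [-1 + _]addrC.
rewrite -(natrB _ n_gt0) subn1.
by rewrite normrN normr1 normr_nat mul1r mulr_natl mulr2n.
Qed.

Lemma tensor_energy (k a : nat) (p1 q1 p2 q2 : algC)
    (e : rel ('I_k * 'I_a)) (e_sym : symmetric e) (e_irrefl : irreflexive e) :
  (0 < k)%N -> (0 < a)%N ->
  (forall x y, (e x y)%:R = pIqJ p1 q1 x.1 y.1 * pIqJ p2 q2 x.2 y.2) ->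
  energy (SGraph e_sym e_irrefl) =
    (\sum_(i < k) `|pIqJ_eigenvalue p1 q1 i|)
    * (\sum_(j < a) `|pIqJ_eigenvalue p2 q2 j|).
Proof.
move=> k_gt0 a_gt0 eE; rewrite /energy.
rewrite (perm_big _ (tensor_spectrum e_sym e_irrefl k_gt0 a_gt0 eE)).
rewrite big_image /=.
under eq_bigr => x _ do rewrite normrM.
by rewrite big_distrlr /= pair_bigA.
Qed.

(** * The three families of graphs *)

Lemma pIqJ_eq (n : nat) (i j : 'I_n) : pIqJ 1 0 i j = (i == j)%:R.
Proof. by rewrite /pIqJ mul1r addr0. Qed.

Lemma pIqJ_neq (n : nat) (i j : 'I_n) : pIqJ (-1) 1 i j = (i != j)%:R.
Proof. by rewrite /pIqJ; case: eqP => _ /=; ring. Qed.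

Lemma pIqJ_true (n : nat) (i j : 'I_n) : pIqJ 0 1 i j = 1.
Proof. by rewrite /pIqJ mul0r add0r. Qed.

Lemma multipartite_tensor (k a : nat) (x y : 'I_k * 'I_a) :
  (multipartite_edge x y)%:R = pIqJ (-1) 1 x.1 y.1 * pIqJ 0 1 x.2 y.2.
Proof. by rewrite pIqJ_neq pIqJ_true mulr1. Qed.

Lemma copies_complete_tensor (k a : nat) (x y : 'I_k * 'I_a) :
  (@copies_edge k (complete a) x y)%:R = pIqJ 1 0 x.1 y.1 * pIqJ (-1) 1 x.2 y.2.
Proof. by rewrite pIqJ_eq pIqJ_neq -natrM mulnb. Qed.

Lemma crown_tensor (a : nat) (x y : 'I_2 * 'I_a) :
  (@crown_edge a x y)%:R = pIqJ (-1) 1 x.1 y.1 * pIqJ (-1) 1 x.2 y.2.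
Proof. by rewrite !pIqJ_neq -natrM mulnb. Qed.

Lemma complete_multipartite_energy (k a : nat) : (0 < k)%N -> (0 < a)%N ->
  energy (complete_multipartite k a) = 2%:R * k.-1%:R * a%:R.
Proof.
move=> k_gt0 a_gt0.
rewrite (tensor_energy _ _ k_gt0 a_gt0 (@multipartite_tensor k a)).
by rewrite neq_absolute_sum // true_absolute_sum.
Qed.

Lemma copies_complete_energy (k a : nat) : (0 < k)%N -> (0 < a)%N ->
  energy (copies k (complete a)) = k%:R * (2%:R * a.-1%:R).
Proof.
move=> k_gt0 a_gt0.
rewrite (tensor_energy _ _ k_gt0 a_gt0 (@copies_complete_tensor k a)).
by rewrite eq_absolute_sum // neq_absolute_sum.
Qed.

Lemma crown_energy (a : nat) : (0 < a)%N ->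
  energy (crown a) = 2%:R * (2%:R * a.-1%:R).
Proof.
move=> a_gt0; rewrite (tensor_energy _ _ _ a_gt0 (@crown_tensor a)) //.
by rewrite !neq_absolute_sum // mulr1.
Qed.

(** The eigenvalue 0 of J gives the eigenvalue 0 of the multipartite graph,
    while those of disjoint copies of K_a' are a' - 1 and -1, both nonzero. *)
Lemma multipartite_not_isospectral (k a k' a' : nat) :
  (0 < k)%N -> (1 < a)%N -> (0 < k')%N -> (1 < a')%N ->
  ~ isospectral (complete_multipartite k a) (copies k' (complete a')).
Proof.
move=> k_gt0 a_gt1 k'_gt0 a'_gt1 /perm_mem/(_ 0).
have -> : 0 \in spectrum (complete_multipartite k a).
  have gE := @multipartite_tensor k a.
  apply/(tensor_mem_spectrum _ _ _ k_gt0 (ltnW a_gt1) gE).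
  (* A second index other than 0 kills the J factor. *)
  exists (Ordinal k_gt0, Ordinal a_gt1).
  by rewrite /= {2}/pIqJ_eigenvalue /=; ring.
have hE := @copies_complete_tensor k' a'.
move/esym; move/(tensor_mem_spectrum _ _ _ k'_gt0 (ltnW a'_gt1) hE).
move=> [[i j]] /= /esym/eqP.
rewrite /pIqJ_eigenvalue mul0r addr0 !mul1r.
have [_|_] := eqVneq (j : nat) 0%N.
  by rewrite mulr1 addrC subr_eq0 pnatr_eq1 eqn_leq leqNgt a'_gt1.
by rewrite mulr0 addr0 oppr_eq0 oner_eq0.
Qed.

(** The crown graph is bipartite, so the opposite 1 - a of its valency is an
    eigenvalue; it would have to be one of a - 1 and -1, that is, a = 1 or
    a = 2. *)
Lemma crown_not_isospectral (a : nat) : (2 < a)%N ->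
  ~ isospectral (crown a) (copies 2 (complete a)).
Proof.
move=> a_gt2 /perm_mem/(_ (1 - a%:R)).
have a_gt0 : (0 < a)%N by apply: leq_trans a_gt2.
have -> : 1 - a%:R \in spectrum (crown a).
  apply/(tensor_mem_spectrum _ _ _ _ a_gt0 (@crown_tensor a)) => //.
  (* Alternating on the two sides, constant on each of them. *)
  exists (Ordinal (isT : (1 < 2)%N), Ordinal a_gt0).
  by rewrite /pIqJ_eigenvalue /=; ring.
have hE := @copies_complete_tensor 2 a.
move/esym; move/(tensor_mem_spectrum _ _ _ _ a_gt0 hE).
move=> /(_ isT) [[i j]] /=.
rewrite /pIqJ_eigenvalue mul0r addr0 !mul1r.
have [_|_] := eqVneq (j : nat) 0%N => /= aE.
  have /eqP : (a + a)%:R - 2%:R = 0 :> algC.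
    by apply: etrans (_ : (-1 + a%:R * 1) - (1 - a%:R) = 0);
      [rewrite natrD; ring | rewrite aE subrr].
  rewrite subr_eq0 eqr_nat => /eqP aa2.
  by have := leq_add a_gt2 a_gt2; rewrite aa2.
have /eqP : a%:R - 2%:R = 0 :> algC.
  by apply: etrans (_ : (-1 + a%:R * 0) - (1 - a%:R) = 0);
    [ring | rewrite aE subrr].
by rewrite subr_eq0 eqr_nat => /eqP aE2; rewrite aE2 in a_gt2.
Qed.

(** * Connectedness *)

Lemma exists_notin (T : finType) (s : seq T) :
  (size s < #|T|)%N -> exists x, x \notin s.
Proof.
move=> s_lt; apply/existsP; apply: contraLR s_lt => /existsPn s_all.
rewrite -leqNgt (leq_trans _ (card_size s)) // subset_leq_card //.
by apply/subsetP=> x _; apply/negPn/s_all.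
Qed.

Lemma copies_disconnected (k : nat) (G : sgraph) (x : G) :
  (1 < k)%N -> ~ connected (copies k G).
Proof.
move=> k_gt1 conn; pose i0 : 'I_k := Ordinal (ltnW k_gt1).
have [j] := @exists_notin 'I_k [:: i0] ltac:(by rewrite card_ord).
rewrite inE => /negP; apply.
have copy_closed : closed (@edge (copies k G)) [pred y | y.1 == i0].
  by move=> y z /andP[/eqP yz _]; rewrite !inE yz.
by have := closed_connect copy_closed (conn (i0, x) (j, x)); rewrite !inE eqxx.
Qed.

Lemma multipartite_connected (k a : nat) :
  (1 < k)%N -> connected (complete_multipartite k a).
Proof.
move=> k_gt1 x y; have [xy|] := eqVneq x.1 y.1; last exact: connect1.
have [l] := @exists_notin 'I_k [:: x.1] ltac:(by rewrite card_ord).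
rewrite inE => lx; apply: (@connect_trans _ _ (l, x.2)); apply: connect1.
  by rewrite /= /multipartite_edge eq_sym.
by rewrite /= /multipartite_edge -xy.
Qed.

(** Two vertices on the same side have a common neighbour, opposite to neither
    of them in the removed matching; this takes three indices. *)
Lemma crown_connected (a : nat) : (2 < a)%N -> connected (crown a).
Proof.
move=> a_gt2.
have same_side (x y : crown a) : x.1 = y.1 -> connect (@edge (crown a)) x y.
  move=> xy.
  have [s] := @exists_notin 'I_2 [:: x.1] ltac:(by rewrite card_ord).
  have [l] := @exists_notin 'I_a [:: x.2; y.2] ltac:(by rewrite card_ord).
  rewrite !inE negb_or => /andP[lx ly] sx.
  apply: (@connect_trans _ _ (s, l)); apply: connect1; apply/andP; split=> //=.
  - by rewrite /multipartite_edge eq_sym.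
  - by rewrite eq_sym.
  - by rewrite /multipartite_edge -xy.
move=> x y; have [/same_side //|xy1] := eqVneq x.1 y.1.
have [l] := @exists_notin 'I_a [:: x.2] ltac:(by rewrite card_ord ltnW).
rewrite inE => lx; apply: (@connect_trans _ _ (y.1, l)); last exact: same_side.
by apply: connect1; apply/andP; split=> //=; rewrite eq_sym.
Qed.

(** * The two pairs *)

Local Close Scope ring_scope.

Theorem corollary4p4 (p t m : nat) (p_prime : prime p) (t_gt0 : 0 < t)
    (m_def : m = p ^ t) :
  (2 <= m ->
     let G := complete_multipartite m m in
     let H := copies m (complete m) in
     [/\ #|G| = m ^ 2, #|H| = m ^ 2, equienergetic G H, ~ isospectral G H
       & exactly_one_connected G H])
  /\
  (3 <= m ->
     let G := crown m in
     let H := copies 2 (complete m) in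
     [/\ #|G| = 2 * m, #|H| = 2 * m, equienergetic G H, ~ isospectral G H
       & exactly_one_connected G H]).
Proof.
split=> [m_gt1|m_gt2] G H.
  have m_gt0 := ltnW m_gt1; pose x : complete m := Ordinal m_gt0.
  have cardG : #|G| = m ^ 2 by rewrite card_prod !card_ord.
  have cardH : #|H| = m ^ 2 by rewrite card_prod !card_ord.
  split=> //.
  - split; first by rewrite cardG.
    rewrite complete_multipartite_energy // copies_complete_energy //.
    by rewrite mulrC.
  - exact: multipartite_not_isospectral.
  - left; split; first exact: multipartite_connected.
    exact: (copies_disconnected x).
have m_gt0 : 0 < m by apply: leq_trans m_gt2.
pose x : complete m := Ordinal m_gt0.
have cardG : #|G| = 2 * m by rewrite card_prod !card_ord.
have cardH : #|H| = 2 * m by rewrite card_prod !card_ord.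
split=> //.
- split; first by rewrite cardG.
  by rewrite crown_energy // copies_complete_energy.
- exact: crown_not_isospectral.
- left; split; first exact: crown_connected.
  exact: (copies_disconnected x).
Qed.
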